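(* Let $n_1,n_2$ be positive integers, $\varepsilon>0$, $\rho_1\in\mathrm{H}_{n_1,++}$, $\rho_2\in\mathrm{H}_{n_2,++}$ with $\operatorname{tr}\rho_1=\operatorname{tr}\rho_2$, and $C\in\mathrm{H}_{n_1n_2}$. For $(X,Y)\in\mathrm{H}_{n_1}\times\mathrm{H}_{n_2}$ let $C(X,Y)=C-X\otimes I_{n_2}-I_{n_1}\otimes Y$, and set $\hat{\mathrm{D}}=\{(X,Y)\in\mathrm{H}_{n_1}\times\mathrm{H}_{n_2}:\ C(X,Y)\succ 0\}$, $\mathrm{D}=\{(X,Y)\in\hat{\mathrm{D}}:\ \operatorname{tr}X=\operatorname{tr}Y\}$, $\beta_Q(X,Y)=-\log\det C(X,Y)$ on $\hat{\mathrm{D}}$, and $$\varphi(X,Y,C)=\operatorname{tr}\rho_1X+\operatorname{tr}\rho_2Y-\varepsilon\beta_Q(X,Y)+n_1n_2\varepsilon(1-\log\varepsilon).$$ Then $\varphi$ is concave on $\hat{\mathrm{D}}$ and strictly concave on $\mathrm{D}$, and $$\max_{(X,Y)\in\hat{\mathrm{D}}}\varphi(X,Y,C)=\max_{(X,Y)\in\mathrm{D}}\varphi(X,Y,C)=\kappa_\beta(C,R,\varepsilon).$$ The function $\varphi$ achieves its maximum on $\hat{\mathrm D}$ exactly on a line $\mathrm{L}=\{(U_1,U_2)+t(I_{n_1},-I_{n_2}):t\in\mathbb{R}\}$, which intersects $\mathrm{D}$ at a unique point $(U_1,U_2)$. Furthermore, $\rho^\star=\varepsilon\,C(X,Y)^{-1}$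 (which is the same for all $(X,Y)\in\mathrm{L}$) is the unique point of $\Gamma_o(R)$ at which $\kappa_\beta(C,R,\varepsilon)$ is achieved.
   Context: $\mathrm{H}_n$ denotes $n\times n$ complex Hermitian matrices, $\mathrm{H}_{n,+}$ ($A\succeq0$) the positive semidefinite and $\mathrm{H}_{n,++}$ ($A\succ0$) the positive definite ones; $\mathrm{H}_{n_1n_2}$ is identified with Hermitian operators on $\mathbb{C}^{n_1}\otimes\mathbb{C}^{n_2}$. For $\rho\in\mathrm{H}_{n_1n_2}$, $\operatorname{tr}_2\rho\in\mathrm{H}_{n_1}$ and $\operatorname{tr}_1\rho\in\mathrm{H}_{n_2}$ are the partial traces over the second and first factor. For $R=(\rho_1,\rho_2)$, $\Gamma(R)=\{\rho\in\mathrm{H}_{n_1n_2,+}:\ \operatorname{tr}_2\rho=\rho_1,\ \operatorname{tr}_1\rho=\rho_2\}$ and $\Gamma_o(R)=\Gamma(R)\cap\mathrm{H}_{n_1n_2,++}$. $\kappa_\beta(C,R,\varepsilon)=\min_{\rho\in\Gamma_o(R)}\big(\operatorname{tr}C\rho-\varepsilon\log\det\rho\big)$. *)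

(* Defs.v *)
From HB Require Import structures.
From mathcomp Require Import all_boot all_order all_algebra.
From mathcomp.real_closed Require Import complex mxtens.
From mathcomp Require Import boolp classical_sets reals exp.
Set Implicit Arguments. Unset Strict Implicit. Unset Printing Implicit Defensive.
Import Order.TTheory GRing.Theory Num.Theory.
Local Open Scope ring_scope.
Local Open Scope classical_set_scope.
Local Open Scope complex_scope.

Section Defs.
Variable R : realType.
Local Notation C := (R[i]).

Definition adjmx m n (A : 'M[C]_(m, n)) : 'M[C]_(n, m) :=
  \matrix_(i, j) (A j i)^*.

Definition herm n (A : 'M[C]_n) : Prop := adjmx A = A.

(* positive semidefinite / positive definite (Hermitian, with v^* A v >= 0 / > 0);
   the order on C = R[i] is: z >= 0 iff z is a nonnegative real. *)
Definition psd n (A : 'M[C]_n) : Prop :=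
  herm A /\ forall v : 'cV[C]_n, 0 <= (adjmx v *m A *m v) ord0 ord0.
Definition pd n (A : 'M[C]_n) : Prop :=
  herm A /\ forall v : 'cV[C]_n, v != 0 -> 0 < (adjmx v *m A *m v) ord0 ord0.

(* partial traces on C^n1 (x) C^n2, Kronecker convention of tensmx:
   (A *t B) (i1,i2) (j1,j2) = A i1 j1 * B i2 j2 *)
Definition ptrace2 n1 n2 (rho : 'M[C]_(n1 * n2)) : 'M[C]_n1 :=
  \matrix_(i, j) \sum_(k < n2) rho (mxtens_index (i, k)) (mxtens_index (j, k)).
Definition ptrace1 n1 n2 (rho : 'M[C]_(n1 * n2)) : 'M[C]_n2 :=
  \matrix_(i, j) \sum_(k < n1) rho (mxtens_index (k, i)) (mxtens_index (k, j)).

Definition Gamma n1 n2 (rho1 : 'M[C]_n1) (rho2 : 'M[C]_n2) : set 'M[C]_(n1 * n2) :=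
  [set rho | psd rho /\ ptrace2 rho = rho1 /\ ptrace1 rho = rho2].
Definition Gamma_o n1 n2 (rho1 : 'M[C]_n1) (rho2 : 'M[C]_n2) : set 'M[C]_(n1 * n2) :=
  Gamma rho1 rho2 `&` [set rho | pd rho].

(* log det of a (positive definite) matrix: its determinant is a positive real *)
Definition logdet n (A : 'M[C]_n) : R := ln (complex.Re (\det A)).

Definition kobj n (Cm : 'M[C]_n) (eps : R) (rho : 'M[C]_n) : R :=
  complex.Re (\tr (Cm *m rho)) - eps * logdet rho.

(* kappa_beta(C,R,eps) = min over Gamma_o(R) of the objective (as an infimum;
   attainment is part of the theorem) *)
Definition kappa_beta n1 n2 (Cm : 'M[C]_(n1 * n2)) (rho1 : 'M[C]_n1)
  (rho2 : 'M[C]_n2) (eps : R) : R :=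
  inf [set kobj Cm eps rho | rho in Gamma_o rho1 rho2].

Definition Cxy n1 n2 (Cm : 'M[C]_(n1 * n2)) (X : 'M[C]_n1) (Y : 'M[C]_n2)
  : 'M[C]_(n1 * n2) :=
  Cm - X *t (1%:M : 'M[C]_n2) - (1%:M : 'M[C]_n1) *t Y.

Definition Dhat n1 n2 (Cm : 'M[C]_(n1 * n2)) (X : 'M[C]_n1) (Y : 'M[C]_n2) : Prop :=
  herm X /\ herm Y /\ pd (Cxy Cm X Y).
Definition Dset n1 n2 (Cm : 'M[C]_(n1 * n2)) (X : 'M[C]_n1) (Y : 'M[C]_n2) : Prop :=
  Dhat Cm X Y /\ \tr X = \tr Y.

Definition betaQ n1 n2 (Cm : 'M[C]_(n1 * n2)) (X : 'M[C]_n1) (Y : 'M[C]_n2) : R :=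
  - logdet (Cxy Cm X Y).

Definition phi n1 n2 (rho1 : 'M[C]_n1) (rho2 : 'M[C]_n2) (eps : R)
  (Cm : 'M[C]_(n1 * n2)) (X : 'M[C]_n1) (Y : 'M[C]_n2) : R :=
  complex.Re (\tr (rho1 *m X)) + complex.Re (\tr (rho2 *m Y))
  - eps * betaQ Cm X Y + (n1 * n2)%:R * eps * (1 - ln eps).

Definition cvx n (t : R) (A B : 'M[C]_n) : 'M[C]_n :=
  (t%:C) *: A + ((1 - t)%:C) *: B.

End Defs.

(* Main.v *)
Require Import Defs.
From HB Require Import structures.
From mathcomp Require Import all_boot all_order all_algebra.
From mathcomp.real_closed Require Import complex mxtens.
From mathcomp Require Import boolp classical_sets reals exp.
From mathcomp Require Import topology normedtype sequences derive.
From mathcomp Require Import ring lra.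
Set Implicit Arguments. Unset Strict Implicit. Unset Printing Implicit Defensive.
Import Order.TTheory GRing.Theory Num.Theory.
Import numFieldNormedType.Exports.
Local Open Scope ring_scope.
Local Open Scope complex_scope.

(* Weak duality is the tangent inequality
   [logdet B <= logdet A + tr (A^-1 B) - n], with equality iff [A = B]: it follows from
   [ln x <= x - 1] after a simultaneous diagonalization by congruence.  Applied to
   [A = eps C(X,Y)^-1] and [B = rho], it gives [phi X Y <= kobj rho], with equality iff
   [rho = eps C(X,Y)^-1]; applied at a convex combination, it gives (strict) concavity.
   Existence is obtained on the primal side, by compactness.  At a minimizer [rho],
   [C - eps rho^-1] is orthogonal to every Hermitian matrix with zero partial traces,
   hence of the form [X *t 1 + 1 *t Y], and [(X, Y)] is then a dual optimum. *)

(** * Adjoints, positive definite matrices and diagonalization by congruence *)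

Section Adjoint.
Variable R : realType.
Local Notation C := R[i].

Lemma ReD (x y : C) : complex.Re (x + y) = complex.Re x + complex.Re y.
Proof. by case: x; case: y. Qed.

Lemma ReN (x : C) : complex.Re (- x) = - complex.Re x.
Proof. by case: x. Qed.

Lemma ReB (x y : C) : complex.Re (x - y) = complex.Re x - complex.Re y.
Proof. by rewrite ReD ReN. Qed.

Lemma ReMl (k : R) (x : C) : complex.Re (k%:C * x) = k * complex.Re x.
Proof. by case: x => a b /=; rewrite mul0r subr0. Qed.

Lemma adjmxE m n (A : 'M[C]_(m, n)) : adjmx A = map_mx Num.conj (A^T).
Proof. by apply/matrixP => i j; rewrite !mxE. Qed.

Lemma adjmxK m n (A : 'M[C]_(m, n)) : adjmx (adjmx A) = A.
Proof. by rewrite !adjmxE trmxCK. Qed.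

Lemma adjmxM m n p (A : 'M[C]_(m, n)) (B : 'M[C]_(n, p)) :
  adjmx (A *m B) = adjmx B *m adjmx A.
Proof. by rewrite !adjmxE trmx_mul map_mxM. Qed.

Lemma adjmxD m n (A B : 'M[C]_(m, n)) : adjmx (A + B) = adjmx A + adjmx B.
Proof. by rewrite !adjmxE linearD /= map_mxD. Qed.

Lemma adjmxN m n (A : 'M[C]_(m, n)) : adjmx (- A) = - adjmx A.
Proof. by rewrite !adjmxE linearN /= map_mxN. Qed.

Lemma adjmxZ m n (k : R) (A : 'M[C]_(m, n)) : adjmx (k%:C *: A) = k%:C *: adjmx A.
Proof. by apply/matrixP => i j; rewrite !mxE rmorphM /= oppr0. Qed.

Lemma adjmx_scalar n (k : R) : adjmx ((k%:C)%:M : 'M[C]_n) = (k%:C)%:M.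
Proof.
by apply/matrixP => i j; rewrite !mxE eq_sym rmorphMn /= oppr0.
Qed.

Lemma adjmx1 n : adjmx (1%:M : 'M[C]_n) = 1%:M.
Proof. exact: (adjmx_scalar n 1). Qed.

Lemma adjmx_unit n (A : 'M[C]_n) : (adjmx A \in unitmx) = (A \in unitmx).
Proof. by rewrite adjmxE map_unitmx unitmx_tr. Qed.

Lemma adjmx_inv n (A : 'M[C]_n) : adjmx (invmx A) = invmx (adjmx A).
Proof. by rewrite !adjmxE trmx_inv map_invmx. Qed.

Lemma det_adjmx n (A : 'M[C]_n) : \det (adjmx A) = (\det A)^*.
Proof. by rewrite adjmxE det_map_mx det_tr. Qed.

Lemma tr_adjmx n (A : 'M[C]_n) : \tr (adjmx A) = (\tr A)^*.
Proof. by rewrite adjmxE trace_map_mx mxtrace_tr. Qed.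

Lemma adjmx_tens m n p q (A : 'M[C]_(m, n)) (B : 'M[C]_(p, q)) :
  adjmx (A *t B) = adjmx A *t adjmx B.
Proof. by rewrite !adjmxE trmx_tens map_mxT. Qed.

Lemma hermD n (A B : 'M[C]_n) : herm A -> herm B -> herm (A + B).
Proof. by rewrite /herm adjmxD => -> ->. Qed.

Lemma hermN n (A : 'M[C]_n) : herm A -> herm (- A).
Proof. by rewrite /herm adjmxN => ->. Qed.

Lemma hermB n (A B : 'M[C]_n) : herm A -> herm B -> herm (A - B).
Proof. by move=> hA hB; apply: hermD => //; apply: hermN. Qed.

Lemma hermZ n (k : R) (A : 'M[C]_n) : herm A -> herm (k%:C *: A).
Proof. by rewrite /herm adjmxZ => ->. Qed.

Lemma herm_scalar n (k : R) : herm ((k%:C)%:M : 'M[C]_n).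
Proof. exact: adjmx_scalar. Qed.

Lemma herm_inv n (A : 'M[C]_n) : herm A -> herm (invmx A).
Proof. by rewrite /herm adjmx_inv => ->. Qed.

Lemma herm_tens m n (A : 'M[C]_m) (B : 'M[C]_n) : herm A -> herm B -> herm (A *t B).
Proof. by rewrite /herm adjmx_tens => -> ->. Qed.

Lemma herm_cong n (S A : 'M[C]_n) : herm A -> herm (adjmx S *m A *m S).
Proof. by rewrite /herm => hA; rewrite !adjmxM adjmxK hA mulmxA. Qed.

Lemma real_of_conj (z : C) : z^* = z -> z = (complex.Re z)%:C.
Proof. by case: z => a b [] /eqP; rewrite eqNr => /eqP ->. Qed.

Lemma herm_tr_real n (A : 'M[C]_n) : herm A -> \tr A = (complex.Re (\tr A))%:C.
Proof. by move=> hA; apply: real_of_conj; rewrite -tr_adjmx hA. Qed.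

Lemma adjmx_gram_ge0 n (v : 'cV[C]_n) : 0 <= (adjmx v *m v) ord0 ord0.
Proof.
by rewrite mxE; apply: sumr_ge0 => i _; rewrite mxE mulrC mulcJ_ge0.
Qed.

Lemma adjmx_gram_gt0 n (v : 'cV[C]_n) : v != 0 -> 0 < (adjmx v *m v) ord0 ord0.
Proof.
move=> v0; rewrite lt_neqAle adjmx_gram_ge0 andbT eq_sym; apply: contra v0.
rewrite mxE psumr_eq0; last by move=> i _; rewrite mxE mulrC mulcJ_ge0.
move=> /allP h; apply/eqP/matrixP => i j; rewrite ord1 [RHS]mxE.
have := h i (mem_index_enum _); rewrite /= mxE mulf_eq0 conjc_eq0 orbb.
by move=> /eqP.
Qed.

(** The form of the new matrix at [v] is the form of [D] at [S *m v], which is nonzero when [v]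
    is. *)
Lemma pd_cong n (S D : 'M[C]_n) : S \in unitmx -> pd D -> pd (adjmx S *m D *m S).
Proof.
move=> uS [hD pD]; split; first exact: herm_cong.
move=> v v0; rewrite !mulmxA -adjmxM -2!mulmxA mulmxA.
by apply: pD; apply: contra v0 => /eqP Sv0; rewrite -[v](mulKmx uS) Sv0 mulmx0.
Qed.

Lemma pd1 n : pd (1%:M : 'M[C]_n).
Proof. by split=> [|v v0]; [exact: adjmx1 | rewrite mulmx1 adjmx_gram_gt0]. Qed.

Lemma pd_gram n (S : 'M[C]_n) : S \in unitmx -> pd (adjmx S *m S).
Proof. by move=> uS; rewrite -[X in X *m S]mulmx1; apply: pd_cong (pd1 n). Qed.

Definition rdiag n (d : 'I_n -> R) : 'M[C]_n := diag_mx (\row_i (d i)%:C).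

Lemma pd_rdiag n (d : 'I_n -> R) : (forall i, 0 < d i) -> pd (rdiag d).
Proof.
move=> d0; have -> : rdiag d = adjmx (rdiag (fun i => Num.sqrt (d i))) *m
    rdiag (fun i => Num.sqrt (d i)).
  apply/matrixP => i j; rewrite mul_mx_diag !mxE eq_sym.
  case: eqP => [->|_]; last by rewrite conjc0 mul0r.
  by rewrite conjc_real -rmorphM /= -expr2 sqr_sqrtr // ltW.
apply: pd_gram; rewrite unitmxE det_diag unitfE; apply/prodf_neq0 => i _.
by rewrite mxE (fmorph_eq0 (real_complex R)) sqrtr_eq0 -ltNge.
Qed.

(** A Hermitian matrix is normal, hence unitarily diagonalizable, and its eigenvalues are real, so
    that taking their real parts loses nothing. *)
Lemma herm_spectral n (A : 'M[C]_n) : herm A ->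
  exists Q : 'M[C]_n, exists d : 'I_n -> R,
    adjmx Q *m Q = 1%:M /\ A = adjmx Q *m rdiag d *m Q.
Proof.
move=> hA.
have hA' : A \is hermsymmx.
  by apply/is_hermitianmxP; rewrite expr0 scale1r -{1}hA adjmxE.
have /hermitian_normalmx/orthomx_spectralP eA := hA'.
exists (spectralmx A), (fun i => complex.Re (spectral_diag A 0 i)).
have eQ : invmx (spectralmx A) = adjmx (spectralmx A).
  have QQ : spectralmx A *m adjmx (spectralmx A) = 1%:M.
    by rewrite adjmxE; apply/unitarymxP/spectral_unitarymx.
  by rewrite -[RHS]mul1mx -(mulVmx (spectral_unit A)) -mulmxA QQ mulmx1.
rewrite -eQ; split; first exact: mulVmx (spectral_unit A).
rewrite {1}eA; congr (_ *m diag_mx _ *m _); apply/rowP => i; rewrite mxE.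
by rewrite RRe_real //; apply: (mxOverP (hermitian_spectral_diag_real hA')).
Qed.

Lemma pd_herm n (A : 'M[C]_n) : pd A -> herm A. Proof. by case. Qed.

Lemma pd_rdiagP n (d : 'I_n -> R) : pd (rdiag d) -> forall i, 0 < d i.
Proof.
move=> [_ pD] i.
have e0 : delta_mx i (0 : 'I_1) != 0 :> 'cV[C]_n.
  by apply/eqP => /matrixP/(_ i 0); rewrite !mxE !eqxx => /eqP; rewrite oner_eq0.
have := pD _ e0; rewrite /rdiag mul_mx_diag mxE (bigD1 i) //= big1 ?addr0.
  by rewrite !mxE !eqxx conjc1 mul1r mulr1 ltcR.
by move=> j /negPf ji; rewrite !mxE ji mulr0.
Qed.

Lemma pd_congP n (S D : 'M[C]_n) : S \in unitmx -> pd (adjmx S *m D *m S) -> pd D.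
Proof.
move=> uS pSD; have -> : D = adjmx (invmx S) *m (adjmx S *m D *m S) *m invmx S.
  by rewrite !mulmxA -adjmxM mulmxV // adjmx1 mul1mx mulmxK.
by apply: pd_cong => //; rewrite unitmx_inv.
Qed.

(** After a spectral decomposition, [S] is the diagonal of the square roots of the eigenvalues times
    the unitary factor. *)
Lemma pd_gramP n (A : 'M[C]_n) : pd A ->
  exists2 S : 'M[C]_n, S \in unitmx & A = adjmx S *m S.
Proof.
move=> pA; have [Q [d [QQ eA]]] := herm_spectral (pd_herm pA).
have uQ : Q \in unitmx by case/mulmx1_unit: QQ.
have d0 : forall i, 0 < d i by apply: pd_rdiagP; apply: (pd_congP uQ); rewrite -eA.
exists (rdiag (fun i => Num.sqrt (d i)) *m Q).
  rewrite unitmx_mul uQ andbT unitmxE det_diag unitfE; apply/prodf_neq0 => i _.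
  by rewrite mxE (fmorph_eq0 (real_complex R)) sqrtr_eq0 -ltNge.
rewrite adjmxM mulmxA -[X in X *m Q]mulmxA {1}eA; congr (_ *m _ *m _).
apply/matrixP => i j; rewrite mul_mx_diag !mxE eq_sym.
case: eqP => [->|_]; last by rewrite conjc0 mul0r.
by rewrite conjc_real -rmorphM /= -expr2 sqr_sqrtr // ltW.
Qed.

(** Write [A] as a Gram matrix of [S], carry [B] to the coordinates given by [S] and diagonalize it
    there by a unitary [Q]; replacing [S] by [Q *m S] leaves the Gram matrix unchanged. *)
Lemma simdiag n (A B : 'M[C]_n) : pd A -> herm B ->
  exists2 S : 'M[C]_n, S \in unitmx & exists d : 'I_n -> R,
    A = adjmx S *m S /\ B = adjmx S *m rdiag d *m S.
Proof.
move=> /pd_gramP[S uS ->] hB.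
have [Q [d [QQ e]]] := herm_spectral (herm_cong (invmx S) hB).
have uQ : Q \in unitmx by case/mulmx1_unit: QQ.
exists (Q *m S); first by rewrite unitmx_mul uQ.
exists d; rewrite adjmxM; split.
  by rewrite -!mulmxA (mulmxA (adjmx Q)) QQ mul1mx.
have -> : adjmx S *m adjmx Q *m rdiag d *m (Q *m S) =
    adjmx S *m (adjmx Q *m rdiag d *m Q) *m S by rewrite !mulmxA.
by rewrite -e !mulmxA -adjmxM mulVmx // adjmx1 mul1mx mulmxKV.
Qed.
End Adjoint.

(** * The log-determinant: tangent inequality and first-order expansion *)

Section LogDet.
Variable R : realType.
Local Notation C := R[i].

Lemma ln_prod (I : Type) (r : seq I) (d : I -> R) : (forall i, 0 < d i) ->
  ln (\prod_(i <- r) d i) = \sum_(i <- r) ln (d i).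
Proof.
move=> d0; elim: r => [|i r IHr]; first by rewrite !big_nil ln1.
by rewrite !big_cons lnM ?IHr // posrE ?d0 // prodr_gt0.
Qed.

Lemma ln_lt_sub1 (x : R) : 0 < x -> x != 1 -> ln x < x - 1.
Proof.
move=> x0 x1; rewrite -ltr_expR lnK ?posrE //.
by rewrite -[ltLHS](subrK 1) addrC expR_gt1Dx // subr_eq0.
Qed.

Lemma ln_le_sub1 (x : R) : 0 < x -> ln x <= x - 1.
Proof.
move=> x0; have [->|x1] := eqVneq x 1; first by rewrite ln1 subrr.
by rewrite ltW // ln_lt_sub1.
Qed.

(** This is [ln y <= y - 1] at [y = (1 + x)^-1], with [y <= 1 - x + 2 * x ^+ 2] as soon as
    [1 + 2 * x >= 0]. *)
Lemma ln1D_ge (x : R) : `|x| <= 2^-1 -> x - 2 * x ^+ 2 <= ln (1 + x).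
Proof.
rewrite ler_norml => /andP[x1 x2].
have x0 : 0 < 1 + x by lra.
have := ln_le_sub1 (_ : 0 < (1 + x)^-1); rewrite invr_gt0 => /(_ x0).
rewrite lnV ?posrE // => h.
suff : (1 + x)^-1 <= 1 - x + 2 * x ^+ 2 by lra.
rewrite -[leLHS]mul1r ler_pdivrMr //.
rewrite -subr_ge0 (_ : _ - _ = x ^+ 2 * (1 + 2 * x)); last by ring.
by rewrite mulr_ge0 ?sqr_ge0 //; lra.
Qed.

Lemma det_pd_gt0 n (A : 'M[C]_n) : pd A -> 0 < \det A.
Proof.
case/pd_gramP => S uS ->; rewrite det_mulmx det_adjmx mulrC.
by rewrite lt_neqAle mulcJ_ge0 eq_sym mulf_neq0 // ?conjc_eq0 -unitfE -unitmxE.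
Qed.

Lemma pd_unit n (A : 'M[C]_n) : pd A -> A \in unitmx.
Proof. by move=> /det_pd_gt0 h; rewrite unitmxE unitfE gt_eqF. Qed.

Lemma det_pd_real n (A : 'M[C]_n) : pd A -> \det A = (complex.Re (\det A))%:C.
Proof. by move=> /det_pd_gt0; case: (\det A) => a b; rewrite ltcE => /andP[/eqP/= ->]. Qed.

Lemma Re_det_pd_gt0 n (A : 'M[C]_n) : pd A -> 0 < complex.Re (\det A).
Proof. by move=> /det_pd_gt0; rewrite ltcE => /andP[]. Qed.

Lemma logdet_cong n (S : 'M[C]_n) (d : 'I_n -> R) : S \in unitmx -> (forall i, 0 < d i) ->
  logdet (adjmx S *m rdiag d *m S) = logdet (adjmx S *m S) + \sum_i ln (d i).
Proof.
move=> uS d0; have pS := Re_det_pd_gt0 (pd_gram uS).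
rewrite /logdet -ln_prod // -lnM ?posrE ?prodr_gt0 //; congr ln.
rewrite mulrC -ReMl; congr complex.Re.
rewrite !det_mulmx det_diag rmorph_prod [LHS]mulrAC [LHS]mulrC; congr (_ * _).
by apply: eq_bigr => i _; rewrite mxE.
Qed.

(** The product under the trace is similar to [rdiag d], through [S]. *)
Lemma Re_tr_inv_cong n (S : 'M[C]_n) (d : 'I_n -> R) : S \in unitmx ->
  complex.Re (\tr (invmx (adjmx S *m S) *m (adjmx S *m rdiag d *m S))) = \sum_i d i.
Proof.
move=> uS; have uG := pd_unit (pd_gram uS).
have -> : adjmx S *m rdiag d *m S = adjmx S *m S *m (invmx S *m rdiag d *m S).
  by rewrite !mulmxA mulmxK.
rewrite mulKmx // mxtrace_mulC mulmxA mulmxV // mul1mx mxtrace_diag.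
have -> : \sum_i (\row_j (d j)%:C) 0 i = (\sum_i d i)%:C :> C.
  by rewrite rmorph_sum; apply: eq_bigr => i _; rewrite mxE.
by [].
Qed.

(** In simultaneous diagonal form this is the sum over [i] of [ln (d i) <= d i - 1]; equality forces
    every [d i] to be 1. *)
Lemma logdet_tangent n (A B : 'M[C]_n) : pd A -> pd B ->
  logdet B <= logdet A + complex.Re (\tr (invmx A *m B)) - n%:R ?= iff (A == B).
Proof.
move=> pA pB; have [S uS [d [eA eB]]] := simdiag pA (pd_herm pB).
have d0 : forall i, 0 < d i by apply: pd_rdiagP; apply: (pd_congP uS); rewrite -eB.
have -> : (A == B) = [forall i, d i == 1].
  apply/eqP/forallP => [AB i|d1].
    have : rdiag d = 1%:M.
      have uS' : adjmx S \in unitmx by rewrite adjmx_unit.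
      apply: (can_inj (mulKmx uS')); apply: (can_inj (mulmxK uS)).
      by rewrite mulmx1 -eA -eB.
    by move=> /matrixP/(_ i i); rewrite !mxE eqxx !mulr1n => -[->].
  rewrite eA eB; have -> : rdiag d = 1%:M; last by rewrite mulmx1.
  by apply/matrixP => i j; rewrite !mxE (eqP (d1 i)).
rewrite eA eB logdet_cong // Re_tr_inv_cong // -addrA.
have -> : \sum_i d i - n%:R = \sum_i (d i - 1).
  by rewrite sumrB sumr_const card_ord.
rewrite (mono_leif (lerD2l _)); apply: leif_sum => i _.
split; first exact: ln_le_sub1.
apply/eqP/eqP => [h|->]; last by rewrite ln1 subrr.
by apply: contra_eq h => /(ln_lt_sub1 (d0 i)); rewrite lt_neqAle => /andP[].
Qed.

(** A one-sided expansion with quadratic error takes the place of the derivative of [logdet]. In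
    simultaneous diagonal form it is [ln1D_ge] at each [t * d i]. *)
Lemma logdet_first_order n (A B : 'M[C]_n) : pd A -> herm B ->
  exists2 delta : R, 0 < delta & exists K : R, forall t, `|t| <= delta ->
    pd (A + t%:C *: B) /\
    logdet A + t * complex.Re (\tr (invmx A *m B)) - t ^+ 2 * K
      <= logdet (A + t%:C *: B).
Proof.
move=> pA hB; have [S uS [d [-> ->]]] := simdiag pA hB.
(* Since [s] dominates every [d i] in absolute value, [t] of size at most [(2 * s)^-1] keeps each
   [t * d i] within 1/2. *)
pose s := 1 + \sum_i `|d i|.
have s0 : 0 < s by rewrite ltr_pwDl // sumr_ge0.
exists (2 * s)^-1; first by rewrite invr_gt0 mulr_gt0.
exists (2 * \sum_i d i ^+ 2) => t ht.
have td i : `|t * d i| <= 2^-1.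
  rewrite normrM; apply: le_trans (ler_wpM2r (normr_ge0 _) ht) _.
  rewrite ler_pdivrMl ?mulr_gt0 // mulrAC divff ?pnatr_eq0 // mul1r /s (bigD1 i) //= addrCA.
  by rewrite lerDl addr_ge0 // sumr_ge0.
have td0 i : 0 < 1 + t * d i by have := td i; rewrite ler_norml => /andP[]; lra.
have -> : adjmx S *m S + t%:C *: (adjmx S *m rdiag d *m S) =
    adjmx S *m rdiag (fun i => 1 + t * d i) *m S.
  have -> : rdiag (fun i => 1 + t * d i) = 1%:M + t%:C *: rdiag d.
    apply/matrixP => i j; rewrite !mxE mulrnAr -mulrnDl; congr (_ *+ _).
    by rewrite rmorphD rmorphM.
  by rewrite mulmxDr mulmx1 mulmxDl -scalemxAr -scalemxAl.
split; first by apply: pd_cong => //; apply: pd_rdiag.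
rewrite logdet_cong // Re_tr_inv_cong // -addrA lerD2l !mulr_sumr -sumrB.
apply: ler_sum => i _; apply: le_trans (ln1D_ge (td i)).
by rewrite le_eqVlt; apply/orP; left; apply/eqP; ring.
Qed.
End LogDet.

(** * Partial traces, and the kernel and range of the map from [(X, Y)] to [X *t 1 + 1 *t Y] *)

Section PartialTrace.
Variable R : realType.
Local Notation C := R[i].

Lemma Re_sum (I : Type) (r : seq I) (F : I -> C) :
  complex.Re (\sum_(i <- r) F i) = \sum_(i <- r) complex.Re (F i).
Proof. by apply: big_morph => //; apply: ReD. Qed.

(** The squared Frobenius norm in real coordinates; it serves both to show that a matrix vanishes
    and to bound its entries. *)
Lemma Re_tr_gram m n (A : 'M[C]_(m, n)) : complex.Re (\tr (adjmx A *m A)) =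
  \sum_i \sum_j (complex.Re (A j i) ^+ 2 + complex.Im (A j i) ^+ 2).
Proof.
rewrite Re_sum; apply: eq_bigr => i _; rewrite mxE Re_sum; apply: eq_bigr => j _.
by rewrite mxE; case: (A j i) => a b /=; ring.
Qed.

Lemma Re_tr_gram_eq0 m n (A : 'M[C]_(m, n)) :
  complex.Re (\tr (adjmx A *m A)) = 0 -> A = 0.
Proof.
have ge0 i j : 0 <= complex.Re (A j i) ^+ 2 + complex.Im (A j i) ^+ 2.
  by rewrite addr_ge0 ?sqr_ge0.
move=> /eqP; rewrite Re_tr_gram psumr_eq0 => [/allP h|i _]; last exact: sumr_ge0.
apply/matrixP => i j; rewrite [RHS]mxE; have := h j (mem_index_enum _).
rewrite /= psumr_eq0 // => /allP/(_ i (mem_index_enum _)) /=.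
rewrite paddr_eq0 ?sqr_ge0 // !sqrf_eq0 => /andP[/eqP h1 /eqP h2].
by apply/eqP; rewrite eq_complex h1 h2 !eqxx.
Qed.

Variables (n1 n2 : nat).
Implicit Types (A X : 'M[C]_n1) (B Y : 'M[C]_n2) (rho : 'M[C]_(n1 * n2)).

Lemma sum_mxtens (F : 'I_(n1 * n2) -> C) :
  \sum_k F k = \sum_i \sum_j F (mxtens_index (i, j)).
Proof.
rewrite pair_big /= (reindex (@mxtens_index n1 n2)) /=.
  by apply: eq_bigr => -[].
by exists (@mxtens_unindex n1 n2) => k _; rewrite ?mxtens_indexK ?mxtens_unindexK.
Qed.

Lemma ptrace2D rho rho' : ptrace2 (rho + rho') = ptrace2 rho + ptrace2 rho'.
Proof. by apply/matrixP => i j; rewrite !mxE -big_split; apply: eq_bigr => k _; rewrite mxE. Qed.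

Lemma ptrace1D rho rho' : ptrace1 (rho + rho') = ptrace1 rho + ptrace1 rho'.
Proof. by apply/matrixP => i j; rewrite !mxE -big_split; apply: eq_bigr => k _; rewrite mxE. Qed.

Lemma ptrace2Z (c : C) rho : ptrace2 (c *: rho) = c *: ptrace2 rho.
Proof. by apply/matrixP => i j; rewrite !mxE mulr_sumr; apply: eq_bigr => k _; rewrite mxE. Qed.

Lemma ptrace1Z (c : C) rho : ptrace1 (c *: rho) = c *: ptrace1 rho.
Proof. by apply/matrixP => i j; rewrite !mxE mulr_sumr; apply: eq_bigr => k _; rewrite mxE. Qed.

Lemma ptrace2B rho rho' : ptrace2 (rho - rho') = ptrace2 rho - ptrace2 rho'.
Proof. by rewrite ptrace2D -scaleN1r ptrace2Z scaleN1r. Qed.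

Lemma ptrace1B rho rho' : ptrace1 (rho - rho') = ptrace1 rho - ptrace1 rho'.
Proof. by rewrite ptrace1D -scaleN1r ptrace1Z scaleN1r. Qed.

Lemma ptrace2_tens A B : ptrace2 (A *t B) = \tr B *: A.
Proof.
apply/matrixP => i j; rewrite !mxE mulr_suml; apply: eq_bigr => k _.
by rewrite tensmxE mulrC.
Qed.

Lemma ptrace1_tens A B : ptrace1 (A *t B) = \tr A *: B.
Proof.
by apply/matrixP => i j; rewrite !mxE mulr_suml; apply: eq_bigr => k _; rewrite tensmxE.
Qed.

Lemma tr_ptrace2 rho : \tr (ptrace2 rho) = \tr rho.
Proof. by rewrite [RHS]sum_mxtens; apply: eq_bigr => i _; rewrite mxE. Qed.

Lemma tr_ptrace1 rho : \tr (ptrace1 rho) = \tr rho.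
Proof.
by rewrite [RHS]sum_mxtens exchange_big; apply: eq_bigr => i _; rewrite mxE.
Qed.

Lemma herm_ptrace2 rho : herm rho -> herm (ptrace2 rho).
Proof.
move=> h; apply/matrixP => i j; rewrite !mxE rmorph_sum; apply: eq_bigr => k _.
by rewrite -{2}h mxE.
Qed.

Lemma herm_ptrace1 rho : herm rho -> herm (ptrace1 rho).
Proof.
move=> h; apply/matrixP => i j; rewrite !mxE rmorph_sum; apply: eq_bigr => k _.
by rewrite -{2}h mxE.
Qed.

(** With [tr_1tens_mul], the duality between partial traces and tensoring with the identity: it
    turns the marginal constraints into the linear terms of the dual. *)
Lemma tr_tens1_mul X rho : \tr ((X *t (1%:M : 'M[C]_n2)) *m rho) = \tr (X *m ptrace2 rho).
Proof.
rewrite [LHS]sum_mxtens; apply: eq_bigr => i _; rewrite mxE.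
under [RHS]eq_bigr => k _ do rewrite mxE mulr_sumr.
rewrite exchange_big; apply: eq_bigr => j _; rewrite mxE sum_mxtens.
apply: eq_bigr => k _; rewrite (bigD1 j) //= big1 ?addr0 => [|l /negPf lj].
  by rewrite tensmxE mxE eqxx mulr1.
by rewrite tensmxE mxE eq_sym lj mulr0 mul0r.
Qed.

Lemma tr_1tens_mul Y rho : \tr (((1%:M : 'M[C]_n1) *t Y) *m rho) = \tr (Y *m ptrace1 rho).
Proof.
rewrite [LHS]sum_mxtens exchange_big; apply: eq_bigr => j _; rewrite mxE.
under [RHS]eq_bigr => k _ do rewrite mxE mulr_sumr.
rewrite exchange_big; apply: eq_bigr => i _; rewrite mxE sum_mxtens.
rewrite (bigD1 i) //= [X in _ + X]big1 ?addr0 => [|l /negPf li].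
  by apply: eq_bigr => k _; rewrite tensmxE mxE eqxx mul1r.
by apply: big1 => k _; rewrite tensmxE mxE eq_sym li !mul0r.
Qed.

Hypotheses (n1_gt0 : (0 < n1)%N) (n2_gt0 : (0 < n2)%N).

Let n1C : (n1%:R : R)%:C * (n1%:R : R)^-1%:C = 1.
Proof. by rewrite -rmorphM divff // pnatr_eq0 -lt0n. Qed.
Let n2C : (n2%:R : R)%:C * (n2%:R : R)^-1%:C = 1.
Proof. by rewrite -rmorphM divff // pnatr_eq0 -lt0n. Qed.
Let natC n : (n%:R : C) = (n%:R : R)%:C.
Proof. by rewrite rmorph_nat. Qed.

(** The two partial traces of the equation make [X] and [Y] scalar matrices. This kernel is the
    direction of the line of dual maximizers. *)
Lemma tens_sum_eq0 X Y : herm X -> X *t (1%:M : 'M[C]_n2) + (1%:M : 'M[C]_n1) *t Y = 0 ->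
  exists c : R, X = (c%:C)%:M /\ Y = - (c%:C)%:M.
Proof.
move=> hX e.
have p0 : ptrace2 (0 : 'M[C]_(n1 * n2)) = 0 by rewrite -(scale0r 0) ptrace2Z scale0r.
have q0 : ptrace1 (0 : 'M[C]_(n1 * n2)) = 0 by rewrite -(scale0r 0) ptrace1Z scale0r.
have := congr1 (@ptrace1 _ _ _) e; rewrite ptrace1D !ptrace1_tens mxtrace1 q0.
have := congr1 (@ptrace2 _ _ _) e; rewrite ptrace2D !ptrace2_tens mxtrace1 p0.
rewrite !natC !scalemx1 => /eqP; rewrite addrC addr_eq0 => /eqP eX /eqP.
rewrite addrC addr_eq0 => /eqP eY.
have eY' : Y = - (((n1%:R)^-1%:C * \tr X)%:M).
  by rewrite -[LHS]scale1r -n1C mulrC -scalerA eY scalerN scale_scalar_mx.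
(* A scalar matrix of size [n1] is its trace divided by [n1]; the trace is real because [X] is
   Hermitian. *)
exists (n1%:R^-1 * complex.Re (\tr X)).
rewrite !(rmorphM (real_complex R)) /= -(herm_tr_real hX); split=> //.
have eX' : X = - ((n2%:R^-1)%:C *: - ((n2%:R)%:C *: X)).
  by rewrite scalerN opprK scalerA mulrC n2C scale1r.
rewrite [LHS]eX' -eX eY' linearN /= mxtrace_scalar -[_ * _ *+ _]mulr_natr (natC n2).
by rewrite raddfN /= scalerN opprK scale_scalar_mx mulrCA [X in _ * X]mulrC n2C mulr1.
Qed.

(* The witness is the orthogonal projection of [H] on the range of
   [(X, Y) |-> X *t 1 + 1 *t Y]: the remainder has zero partial traces. *)
Lemma orthogonal_ptrace_ker (H : 'M[C]_(n1 * n2)) : herm H ->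
  (forall D : 'M[C]_(n1 * n2), herm D -> ptrace2 D = 0 -> ptrace1 D = 0 ->
     complex.Re (\tr (H *m D)) = 0) ->
  exists X, exists Y, [/\ herm X, herm Y &
    H = X *t (1%:M : 'M[C]_n2) + (1%:M : 'M[C]_n1) *t Y].
Proof.
move=> hH orth; pose t : R := complex.Re (\tr H).
have tH : \tr H = t%:C by apply: herm_tr_real.
pose X := (n2%:R^-1)%:C *: ptrace2 H.
(* The trace part of [H] is already carried by [X]; the scalar subtracted here makes [Y] traceless,
   so that it is not counted twice. *)
pose Y := (n1%:R^-1)%:C *: ptrace1 H - ((t / n1%:R / n2%:R)%:C)%:M.
have hX : herm X by apply/hermZ/herm_ptrace2.
have hY : herm Y by apply: hermB; [apply/hermZ/herm_ptrace1 | apply: herm_scalar].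
exists X, Y; split=> //.
have h1 n : herm (1%:M : 'M[C]_n) by apply: adjmx1.
pose D := H - X *t (1%:M : 'M[C]_n2) - (1%:M : 'M[C]_n1) *t Y.
have hD : herm D by apply: hermB; [apply: hermB|] => //; apply: herm_tens.
have trY : \tr Y = 0.
  rewrite linearB linearZ /= mxtrace_scalar tr_ptrace1 tH -[X in _ - X]mulr_natr (natC n2).
  rewrite rmorphM /= -mulrA [X in _ - _ * X]mulrC n2C mulr1 rmorphM mulrC.
  by rewrite subrr.
have trX : \tr X = (t / n2%:R)%:C.
  by rewrite linearZ /= tr_ptrace2 tH -rmorphM mulrC.
have D2 : ptrace2 D = 0.
  rewrite !ptrace2B !ptrace2_tens mxtrace1 trY scale0r subr0 natC.
  by rewrite scalerA n2C scale1r subrr.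
have D1 : ptrace1 D = 0.
  rewrite !ptrace1B !ptrace1_tens mxtrace1 trX natC scalerBr scalerA n1C scale1r.
  rewrite !scale_scalar_mx mulr1 -rmorphM.
  have -> : n1%:R * (t / n1%:R / n2%:R) = t / n2%:R :> R.
    by rewrite mulrAC mulrC mulfVK ?pnatr_eq0 -?lt0n.
  exact: subrr.
suff : D = 0 by move=> /eqP; rewrite /D -addrA -opprD subr_eq0 => /eqP.
(* [D] and [H] differ by an element of the range, which is orthogonal to such [Z]. At [Z = D] the
   left side is the squared norm of [D], and the right side has real part zero. *)
have trD Z : ptrace2 Z = 0 -> ptrace1 Z = 0 -> \tr (D *m Z) = \tr (H *m Z).
  move=> Z2 Z1; rewrite !mulmxBl !raddfB /= tr_tens1_mul tr_1tens_mul Z1 Z2.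
  by rewrite !mulmx0 !mxtrace0 !subr0.
by apply: Re_tr_gram_eq0; rewrite hD trD ?orth.
Qed.
End PartialTrace.

(** * Continuity of complex and matrix valued functions *)

Section ComplexContinuity.
Local Open Scope classical_set_scope.
Variables (R : realType) (T : topologicalType).
Local Notation C := R[i].

(** Continuity is expressed by real and imaginary parts, so that only real-valued functions have to
    be handled. *)
Definition ccont (F : T -> C) : Prop :=
  continuous (fun x => complex.Re (F x)) /\ continuous (fun x => complex.Im (F x)).

Definition mcont m n (M : T -> 'M[C]_(m, n)) : Prop :=
  forall i j, ccont (fun x => M x i j).

Lemma ccont_cst (c : C) : ccont (fun=> c).
Proof. by split; apply: cst_continuous. Qed.

Lemma ccontD (F G : T -> C) : ccont F -> ccont G -> ccont (fun x => F x + G x).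
Proof.
move=> [F1 F2] [G1 G2]; split.
  have -> : (fun x => complex.Re (F x + G x)) =
    (fun x => complex.Re (F x) + complex.Re (G x)) by apply/funext => x; rewrite ReD.
  by move=> x; apply: cvgD; [apply: F1|apply: G1].
have -> : (fun x => complex.Im (F x + G x)) =
  (fun x => complex.Im (F x) + complex.Im (G x)).
  by apply/funext => x; case: (F x); case: (G x).
by move=> x; apply: cvgD; [apply: F2|apply: G2].
Qed.

Lemma ccontM (F G : T -> C) : ccont F -> ccont G -> ccont (fun x => F x * G x).
Proof.
move=> [F1 F2] [G1 G2]; split.
  have -> : (fun x => complex.Re (F x * G x)) = (fun x =>
      complex.Re (F x) * complex.Re (G x) - complex.Im (F x) * complex.Im (G x)).
    by apply/funext => x; case: (F x); case: (G x).
  move=> x; apply: cvgB; apply: cvgM;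
    by [apply: F1|apply: G1|apply: F2|apply: G2].
have -> : (fun x => complex.Im (F x * G x)) = (fun x =>
    complex.Re (F x) * complex.Im (G x) + complex.Im (F x) * complex.Re (G x)).
  by apply/funext => x; case: (F x); case: (G x).
move=> x; apply: cvgD; apply: cvgM;
  by [apply: F1|apply: G1|apply: F2|apply: G2].
Qed.

Lemma ccont_conj (F : T -> C) : ccont F -> ccont (fun x => (F x)^*).
Proof.
move=> [F1 F2]; split.
  have -> : (fun x => complex.Re (F x)^*) = (fun x => complex.Re (F x)).
    by apply/funext => x; case: (F x).
  exact: F1.
have -> : (fun x => complex.Im (F x)^*) = (fun x => - complex.Im (F x)).
  by apply/funext => x; case: (F x).
by move=> x; apply: cvgN; apply: F2.
Qed.

Lemma continuous_Re_expR (F G : T -> C) (k : R) : ccont F -> ccont G ->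
  continuous (fun x => complex.Re (F x) * expR (- (complex.Re (G x) / k))).
Proof.
move=> [F1 _] [G1 _] x; apply: cvgM; first exact: F1.
apply: (@continuous_comp _ _ _ (fun y => - (complex.Re (G y) / k)) expR).
  by apply: cvgN; apply: cvgM; [apply: G1 | apply: cvg_cst].
exact: continuous_expR.
Qed.

Lemma ccont_sum (I : Type) (r : seq I) (F : I -> T -> C) :
  (forall i, ccont (F i)) -> ccont (fun x => \sum_(i <- r) F i x).
Proof.
move=> hF; elim: r => [|i r IHr].
  by under eq_fun do rewrite big_nil; apply: ccont_cst.
by under eq_fun do rewrite big_cons; apply: ccontD.
Qed.

Lemma ccont_prod (I : Type) (r : seq I) (F : I -> T -> C) :
  (forall i, ccont (F i)) -> ccont (fun x => \prod_(i <- r) F i x).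
Proof.
move=> hF; elim: r => [|i r IHr].
  by under eq_fun do rewrite big_nil; apply: ccont_cst.
by under eq_fun do rewrite big_cons; apply: ccontM.
Qed.

Lemma mcont_cst m n (A : 'M[C]_(m, n)) : mcont (fun=> A).
Proof. by move=> i j; apply: ccont_cst. Qed.

Lemma mcont_adjmx m n (M : T -> 'M[C]_(m, n)) :
  mcont M -> mcont (fun x => adjmx (M x)).
Proof.
by move=> hM i j; under eq_fun do rewrite mxE; apply: ccont_conj; apply: hM.
Qed.

Lemma mcont_mulmx m n p (M : T -> 'M[C]_(m, n)) (N : T -> 'M[C]_(n, p)) :
  mcont M -> mcont N -> mcont (fun x => M x *m N x).
Proof.
move=> hM hN i j; under eq_fun do rewrite mxE.
by apply: ccont_sum => k; apply: ccontM; [apply: hM|apply: hN].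
Qed.

Lemma mcont_ptrace2 m n (M : T -> 'M[C]_(m * n)) :
  mcont M -> mcont (fun x => ptrace2 (M x)).
Proof.
by move=> hM i j; under eq_fun do rewrite mxE; apply: ccont_sum => k; apply: hM.
Qed.

Lemma mcont_ptrace1 m n (M : T -> 'M[C]_(m * n)) :
  mcont M -> mcont (fun x => ptrace1 (M x)).
Proof.
by move=> hM i j; under eq_fun do rewrite mxE; apply: ccont_sum => k; apply: hM.
Qed.

Lemma ccont_tr n (M : T -> 'M[C]_n) : mcont M -> ccont (fun x => \tr (M x)).
Proof. by move=> hM; apply: ccont_sum => i; apply: hM. Qed.

Lemma ccont_det n (M : T -> 'M[C]_n) : mcont M -> ccont (fun x => \det (M x)).
Proof.
move=> hM; apply: ccont_sum => s; apply: ccontM; first exact: ccont_cst.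
by apply: ccont_prod => i; apply: hM.
Qed.

(** The set is an intersection, over the entries, of preimages of points under continuous real
    functions. *)
Lemma closed_mx_eq m n (M : T -> 'M[C]_(m, n)) (B : 'M[C]_(m, n)) :
  mcont M -> closed [set x | M x = B].
Proof.
move=> hM; pose F (k : 'I_m * 'I_n) :=
  (fun x => complex.Re (M x k.1 k.2)) @^-1` [set y | y = complex.Re (B k.1 k.2)] `&`
  (fun x => complex.Im (M x k.1 k.2)) @^-1` [set y | y = complex.Im (B k.1 k.2)].
have -> : [set x | M x = B] = \bigcap_(k in setT) F k.
  apply/seteqP; split => [x /= xB k _|x h]; first by rewrite /F /= xB.
  apply/matrixP => i j; have [/= h1 h2] := h (i, j) I.
  by apply/eqP; rewrite eq_complex h1 h2 !eqxx.
apply: closed_bigI => k _; have [h1 h2] := hM k.1 k.2.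
by apply: closedI; apply: preimage_closed; try exact: closed_eq;
  move=> x _; [apply: h1 | apply: h2].
Qed.
End ComplexContinuity.

(** * Existence of a primal minimizer by compactness *)

Section Minimizer.
Local Open Scope classical_set_scope.
Variable R : realType.
Local Notation C := R[i].

(** Real coordinates on complex matrices, real parts first, which give access to compactness of
    boxes in a real space. *)
Definition mx_of_rV n (v : 'rV[R]_(n * n + n * n)) : 'M[C]_n :=
  \matrix_(i, j) (v 0 (lshift _ (mxvec_index i j)) +i* v 0 (rshift _ (mxvec_index i j))).

Definition rV_of_mx n (A : 'M[C]_n) : 'rV[R]_(n * n + n * n) :=
  row_mx (mxvec (map_mx (@complex.Re R) A)) (mxvec (map_mx (@complex.Im R) A)).

Lemma rV_of_mxK n : cancel (@rV_of_mx n) (@mx_of_rV n).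
Proof.
move=> A; apply/matrixP => i j; rewrite mxE row_mxEl row_mxEr !mxvecE !mxE.
by case: (A i j).
Qed.

Lemma mcont_mx_of_rV n : mcont (@mx_of_rV n).
Proof.
by move=> i j; split; under eq_fun do rewrite mxE /=; apply: coord_continuous.
Qed.

(** On [A] the sum of the squares of all coordinates is [tau], so [A] is a closed subset of a
    box. *)
Lemma compact_gram_fiber n (A : set 'rV[R]_(n * n + n * n)) (tau : R) :
  closed A ->
  (forall v, A v -> complex.Re (\tr (adjmx (mx_of_rV v) *m mx_of_rV v)) = tau) ->
  compact A.
Proof.
move=> clA trA.
have cK : compact [set v : 'rV[R]_(n * n + n * n) |
    forall k, `[- (1 + tau), 1 + tau]%classic (v ord0 k)].
  by apply: (@rV_compact _ _ (fun=> `[- (1 + tau), 1 + tau]%classic)) => _; exact: segment_compact.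
apply: subclosed_compact clA cK _ => v Av k /=.
(* The half-width [1 + tau] dominates the square root of [tau] and spares its use. *)
have le_tau x : x ^+ 2 <= tau -> - (1 + tau) <= x <= 1 + tau.
  by move=> x2; have := sqr_ge0 (x - 1); have := sqr_ge0 (x + 1); nra.
have ge0 i j : 0 <= complex.Re (mx_of_rV v j i) ^+ 2 + complex.Im (mx_of_rV v j i) ^+ 2.
  by rewrite addr_ge0 ?sqr_ge0.
have entry i j :
    complex.Re (mx_of_rV v j i) ^+ 2 + complex.Im (mx_of_rV v j i) ^+ 2 <= tau.
  rewrite -(trA v Av) Re_tr_gram (bigD1 i) //= (bigD1 j) //= -addrA lerDl.
  by rewrite addr_ge0 ?sumr_ge0 // => *; rewrite ?sumr_ge0.
rewrite in_itv /=; apply: le_tau; case: (split_ordP k) => l ->; case/mxvec_indexP: l => i j.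
  by apply: le_trans (entry j i); rewrite !mxE /= lerDl sqr_ge0.
by apply: le_trans (entry j i); rewrite !mxE /= lerDr sqr_ge0.
Qed.

Lemma pd_psd n (A : 'M[C]_n) : pd A -> psd A.
Proof.
move=> [hA pA]; split=> // v; have [->|/pA/ltW //] := eqVneq v 0.
by rewrite mulmx0 mxE.
Qed.

Lemma pd_scale n (k : R) (A : 'M[C]_n) : 0 < k -> pd A -> pd (k%:C *: A).
Proof.
move=> k0 [hA pA]; split=> [|v v0]; first exact: hermZ.
by rewrite -scalemxAr -scalemxAl mxE mulr_gt0 ?pA // ltcR.
Qed.

Lemma pd_tens n1 n2 (A : 'M[C]_n1) (B : 'M[C]_n2) : (0 < n1)%N -> (0 < n2)%N ->
  pd A -> pd B -> pd (A *t B).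
Proof.
rewrite !lt0n => h1 h2 /pd_gramP[S uS ->] /pd_gramP[T uT ->].
by rewrite -tensmx_mul -adjmx_tens; apply: pd_gram; apply: tensmx_unit.
Qed.

Lemma pd_tr_gt0 n (A : 'M[C]_n) : (0 < n)%N -> pd A -> 0 < complex.Re (\tr A).
Proof.
move=> n0 /pd_gramP[S uS ->]; rewrite lt_neqAle Re_tr_gram; apply/andP; split.
  rewrite -Re_tr_gram eq_sym; apply/eqP => /Re_tr_gram_eq0 S0.
  by move: uS; rewrite S0 unitmxE -(scale0r 1%:M) detZ expr0n gtn_eqF // mul0r unitr0.
by apply: sumr_ge0 => i _; apply: sumr_ge0 => j _; rewrite addr_ge0 ?sqr_ge0.
Qed.

(** Feasibility: each marginal of the tensor product is multiplied by the trace of the other factor,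
    and one division by the common trace corrects both. *)
Lemma Gamma_o_product n1 n2 (rho1 : 'M[C]_n1) (rho2 : 'M[C]_n2) :
  (0 < n1)%N -> (0 < n2)%N -> pd rho1 -> pd rho2 -> \tr rho1 = \tr rho2 ->
  Gamma_o rho1 rho2 (((complex.Re (\tr rho1))^-1)%:C *: (rho1 *t rho2)).
Proof.
move=> n1_gt0 n2_gt0 p1 p2 e.
have t0 := pd_tr_gt0 n1_gt0 p1.
have p : pd (((complex.Re (\tr rho1))^-1)%:C *: (rho1 *t rho2)).
  by apply: pd_scale; rewrite ?invr_gt0 //; apply: pd_tens.
have tt : ((complex.Re (\tr rho1))^-1)%:C * \tr rho1 = 1.
  by rewrite [X in _ * X](herm_tr_real (pd_herm p1)) -rmorphM mulVf ?gt_eqF.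
split; last exact: p; split; first exact: pd_psd.
by rewrite ptrace2Z ptrace1Z ptrace2_tens ptrace1_tens !scalerA -e tt !scale1r.
Qed.

(* Parametrizing [rho = T^* T], minimizing [kobj] is maximizing the continuous function
   [det rho * exp (- tr (C rho) / eps)] over a compact set; the maximum is positive, so
   it is attained at an invertible [T]. *)
Lemma kobj_min_exists n1 n2 (rho1 : 'M[C]_n1) (rho2 : 'M[C]_n2)
    (Cm : 'M[C]_(n1 * n2)) (eps : R) :
  0 < eps -> Gamma_o rho1 rho2 !=set0 ->
  exists2 rho, Gamma_o rho1 rho2 rho &
    forall sigma, Gamma_o rho1 rho2 sigma -> kobj Cm eps rho <= kobj Cm eps sigma.
Proof.
move=> eps0 [rho0 G0].
pose T := @mx_of_rV (n1 * n2); pose G v := adjmx (T v) *m T v.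
have cT : mcont T by apply: mcont_mx_of_rV.
have cG : mcont G by apply: mcont_mulmx => //; apply: mcont_adjmx.
(* A Gram matrix is positive semidefinite by construction, so only closed conditions remain; the
   first one fixes the trace of [G v], hence the norm of [T v]. *)
pose A := [set v | ptrace2 (G v) = rho1] `&` [set v | ptrace1 (G v) = rho2].
have clA : closed A.
  by apply: closedI; apply: closed_mx_eq; [apply: mcont_ptrace2|apply: mcont_ptrace1].
have cA : compact A.
  apply: (@compact_gram_fiber _ A (complex.Re (\tr rho1)) clA) => v [/= <- _].
  by rewrite tr_ptrace2.
pose g v := complex.Re (\det (G v)) * expR (- (complex.Re (\tr (Cm *m G v)) / eps)).
have cg : continuous g.
  apply: continuous_Re_expR; first exact: ccont_det.
  by apply: ccont_tr; apply: mcont_mulmx => //; apply: mcont_cst.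
have param sigma : Gamma_o rho1 rho2 sigma -> exists2 v, A v & G v = sigma.
  move=> [[_ [s2 s1]] ps]; have [S uS eS] := pd_gramP ps.
  have eG : G (rV_of_mx S) = sigma by rewrite /G /T rV_of_mxK.
  by exists (rV_of_mx S) => //; split; rewrite /= eG.
have [v0 Av0 eG0] := param _ G0.
have [v /[!inE] Av gmax] := compact_EVT_max (ex_intro _ v0 Av0) cA
  (continuous_subspaceT cg).
have gv0 : 0 < g v.
  have := gmax v0; rewrite inE => /(_ Av0); apply: lt_le_trans.
  rewrite /g eG0 mulr_gt0 ?expR_gt0 //; apply: Re_det_pd_gt0; exact: G0.2.
(* [g] vanishes at singular [T v], so a positive maximum keeps the maximizer away from the boundary
   of the cone. *)
have uT : T v \in unitmx.
  rewrite unitmxE unitfE; apply: contraTneq gv0 => dT.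
  by rewrite /g det_mulmx dT mulr0 /= mul0r ltxx.
have pG : pd (G v) by apply: pd_gram.
(* As [eps] is positive, maximizing [g] is minimizing the objective. *)
have ln_g w : pd (G w) -> kobj Cm eps (G w) = - (eps * ln (g w)).
  move=> pw; rewrite /g lnM ?posrE ?expR_gt0 ?Re_det_pd_gt0 // expRK /kobj /logdet.
  by field; rewrite gt_eqF.
exists (G v); first by split=> //; split; [exact: pd_psd | exact: Av].
move=> sigma Gs; have [w Aw ew] := param _ Gs.
have pw : pd (G w) by rewrite ew; exact: Gs.2.
have gw0 : 0 < g w by rewrite /g mulr_gt0 ?expR_gt0 ?Re_det_pd_gt0.
have gwv : g w <= g v by apply: gmax; rewrite inE.
rewrite -ew (ln_g _ pG) (ln_g _ pw); clear -eps0 gv0 gw0 gwv.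
by move: (g v) (g w) gv0 gw0 gwv => x y x0 y0 xy; rewrite lerN2 ler_pM2l // ler_ln.
Qed.
End Minimizer.

(** * Concavity, weak duality and stationarity of primal minimizers *)

Section Duality.
Local Open Scope classical_set_scope.
Variable R : realType.
Local Notation C := R[i].

Lemma cvx_id n (t : R) (A : 'M[C]_n) : cvx t A A = A.
Proof. by rewrite /cvx -scalerDl -rmorphD addrC subrK scale1r. Qed.

Lemma pd_cvx n (t : R) (A B : 'M[C]_n) : 0 <= t <= 1 -> pd A -> pd B -> pd (cvx t A B).
Proof.
move=> /andP[]; rewrite le_eqVlt => /predU1P[<- _ pA pB|t0].
  by rewrite /cvx subr0 scale0r add0r scale1r.
rewrite le_eqVlt => /predU1P[-> pA pB|t1 pA pB].
  by rewrite /cvx subrr scale0r addr0 scale1r.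
have [hA qA] := pd_scale t0 pA.
have [|hB qB] := @pd_scale _ _ (1 - t) _ _ pB; first by rewrite subr_gt0.
split=> [|v v0]; first exact: hermD.
by rewrite mulmxDr mulmxDl mxE addr_gt0 ?qA ?qB.
Qed.

Lemma pd_inv n (A : 'M[C]_n) : pd A -> pd (invmx A).
Proof.
move=> pA; have uA := pd_unit pA; have := pd_cong (_ : invmx A \in unitmx) pA.
by rewrite unitmx_inv (herm_inv (pd_herm pA)) mulVmx // mul1mx; apply.
Qed.

Lemma Re_tr_cvx n (t : R) (A X Y : 'M[C]_n) : complex.Re (\tr (A *m cvx t X Y)) =
  t * complex.Re (\tr (A *m X)) + (1 - t) * complex.Re (\tr (A *m Y)).
Proof.
by rewrite mulmxDr -!scalemxAr mxtraceD !mxtraceZ ReD !ReMl.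
Qed.

Lemma cvx_neq n (t : R) (A B : 'M[C]_n) : t < 1 -> A != B -> cvx t A B != A.
Proof.
move=> t1; apply: contra => /eqP; rewrite -{2}(cvx_id t A) => /addrI e.
have t1C : (1 - t)%:C != 0 :> C by rewrite fmorph_eq0 subr_eq0 eq_sym lt_eqF.
by move: e => /(scalerI t1C) ->.
Qed.

(** Average the tangent inequalities at [M = cvx t A B] in the directions of [A] and [B]: the trace
    terms average to the trace of [invmx M *m M], which is [n] and cancels. *)
Lemma logdet_concave n (t : R) (A B : 'M[C]_n) : 0 <= t <= 1 -> pd A -> pd B ->
  t * logdet A + (1 - t) * logdet B <= logdet (cvx t A B).
Proof.
move=> t01 pA pB; have pM := pd_cvx t01 pA pB.
have [hA _] := logdet_tangent pM pA; have [hB _] := logdet_tangent pM pB.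
have := Re_tr_cvx t (invmx (cvx t A B)) A B.
rewrite mulVmx ?pd_unit // mxtrace1 -(rmorph_nat (real_complex R)) /= => e.
by move: t01 => /andP[t0 t1]; nra.
Qed.

(** The same average; the inequality for [A] is now strict because the convex combination differs
    from [A]. *)
Lemma logdet_strict_concave n (t : R) (A B : 'M[C]_n) : 0 < t < 1 -> pd A -> pd B ->
  A != B -> t * logdet A + (1 - t) * logdet B < logdet (cvx t A B).
Proof.
move=> /andP[t0 t1] pA pB nAB.
have pM : pd (cvx t A B) by apply: pd_cvx => //; rewrite !ltW.
have := lt_leif (logdet_tangent pM pA); rewrite cvx_neq // => hA.
have [hB _] := logdet_tangent pM pB.
have := Re_tr_cvx t (invmx (cvx t A B)) A B.
rewrite mulVmx ?pd_unit // mxtrace1 -(rmorph_nat (real_complex R)) /= => e.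
by nra.
Qed.

Lemma logdet_scale_inv n (k : R) (A : 'M[C]_n) : 0 < k -> pd A ->
  logdet (k%:C *: invmx A) = n%:R * ln k - logdet A.
Proof.
move=> k0 pA; rewrite /logdet detZ det_inv -rmorphXn ReMl.
have d0 := Re_det_pd_gt0 pA.
rewrite (det_pd_real pA) -fmorphV /= lnM ?posrE ?exprn_gt0 ?invr_gt0 //.
by rewrite lnXn // lnV ?posrE // mulr_natl.
Qed.

(** At [t = - s * a] the quadratic is [s * (s * k - 1) * a ^+ 2], which is negative for small [s]
    unless [a] is zero. *)
Lemma quadratic_ge0_eq0 (delta a k : R) : 0 < delta ->
  (forall t, `|t| <= delta -> 0 <= t * a + t ^+ 2 * k) -> a = 0.
Proof.
(* The first bound keeps [t] within [delta], the second gives [s * k < 1]. *)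
move=> d0 h; pose s := Num.min (delta / (1 + `|a|)) (1 + `|k|)^-1.
have a1 : 0 < 1 + `|a| by rewrite ltr_pwDl.
have k1 : 0 < 1 + `|k| by rewrite ltr_pwDl.
have s0 : 0 < s by rewrite lt_min divr_gt0 ?invr_gt0.
have sa : `|- s * a| <= delta.
  have : s <= delta / (1 + `|a|) by rewrite ge_min lexx.
  rewrite ler_pdivlMr // normrM normrN (gtr0_norm s0); apply: le_trans.
  by rewrite ler_pM2l // lerDr.
have sk : s * k < 1.
  have : s <= (1 + `|k|)^-1 by rewrite ge_min lexx orbT.
  rewrite -[leRHS]mul1r ler_pdivlMr //; apply: lt_le_trans.
  by rewrite ltr_pM2l // (le_lt_trans (ler_norm k)) // ltrDr.
have := h _ sa; rewrite (_ : _ + _ = s * (s * k - 1) * a ^+ 2); last by ring.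
rewrite nmulr_rge0; last by rewrite pmulr_rlt0 // subr_lt0.
by move=> a2; apply/eqP; rewrite -sqrf_eq0 eq_le a2 sqr_ge0.
Qed.

Lemma inf_min (A : set R) (m : R) : A m -> (forall x, A x -> m <= x) -> inf A = m.
Proof.
move=> Am lb; apply/eqP; rewrite eq_le ge_inf //=; last by exists m.
by apply: lb_le_inf => //; exists m.
Qed.

Variables (n1 n2 : nat).
Implicit Types (X : 'M[C]_n1) (Y : 'M[C]_n2) (rho Cm : 'M[C]_(n1 * n2)).

Lemma Cxy_cvx Cm X1 X2 Y1 Y2 (t : R) :
  Cxy Cm (cvx t X1 X2) (cvx t Y1 Y2) = cvx t (Cxy Cm X1 Y1) (Cxy Cm X2 Y2).
Proof. by apply/matrixP => i j; rewrite !mxE rmorphB /=; ring. Qed.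

Lemma Cxy_shift Cm X Y (t : R) :
  Cxy Cm (X + (t%:C)%:M) (Y - (t%:C)%:M) = Cxy Cm X Y.
Proof.
by apply/matrixP => i j; rewrite !mxE -!(mulr_natr t%:C); ring.
Qed.

(** The Lagrangian identity: once the partial traces of [rho] are fixed, the last two terms are the
    linear part of [phi]. *)
Lemma tr_Cxy Cm X Y rho : \tr (Cm *m rho) =
  \tr (Cxy Cm X Y *m rho) + \tr (X *m ptrace2 rho) + \tr (Y *m ptrace1 rho).
Proof.
by rewrite !mulmxBl !raddfB /= tr_tens1_mul tr_1tens_mul; ring.
Qed.

(** This governs both the line of maximizers and, with the trace condition, strict concavity on
    [Dset]. *)
Lemma Cxy_inj Cm X1 Y1 X2 Y2 : (0 < n1)%N -> (0 < n2)%N -> herm X1 -> herm X2 ->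
  Cxy Cm X1 Y1 = Cxy Cm X2 Y2 ->
  exists c : R, X1 = X2 + (c%:C)%:M /\ Y1 = Y2 - (c%:C)%:M.
Proof.
move=> n1_gt0 n2_gt0 h1 h2 e.
have : (X1 - X2) *t (1%:M : 'M[C]_n2) + (1%:M : 'M[C]_n1) *t (Y1 - Y2) = 0.
  transitivity (Cxy Cm X2 Y2 - Cxy Cm X1 Y1); last by rewrite e subrr.
  by apply/matrixP => i j; rewrite !mxE; ring.
move=> /(tens_sum_eq0 n1_gt0 n2_gt0 (hermB h1 h2))[c [eX eY]].
by exists c; rewrite -eX -eY !addrA ![_ + X1]addrC ![_ + Y1]addrC !addrK.
Qed.

(** The shift changes the difference of the two traces by [t * (n1 + n2)]. *)
Lemma Dset_shift_eq0 Cm X Y (t : R) : (0 < n1)%N -> \tr X = \tr Y ->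
  Dset Cm (X + (t%:C)%:M) (Y - (t%:C)%:M) -> t = 0.
Proof.
move=> n1_gt0 e [_]; rewrite linearD linearB /= !mxtrace_scalar e => /addrI.
move=> /eqP; rewrite -addr_eq0 -mulrnDr mulrn_eq0 addn_eq0 -!leqn0.
by rewrite leqNgt n1_gt0 fmorph_eq0 /= => /eqP.
Qed.

Variables (rho1 : 'M[C]_n1) (rho2 : 'M[C]_n2) (eps : R).
Hypothesis eps_gt0 : 0 < eps.

(** All terms of [phi] but the log-determinant are affine in [(X, Y)]. *)
Lemma phi_cvx Cm X1 Y1 X2 Y2 (t : R) (f := phi rho1 rho2 eps Cm) :
  f (cvx t X1 X2) (cvx t Y1 Y2) - (t * f X1 Y1 + (1 - t) * f X2 Y2) =
  eps * (logdet (cvx t (Cxy Cm X1 Y1) (Cxy Cm X2 Y2)) -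
    (t * logdet (Cxy Cm X1 Y1) + (1 - t) * logdet (Cxy Cm X2 Y2))).
Proof.
rewrite /f /phi /betaQ Cxy_cvx !Re_tr_cvx; do 4!move: (complex.Re _) => ?.
by do 3!move: (logdet _) => ?; ring.
Qed.

Lemma phi_shift Cm X Y (t : R) : \tr rho1 = \tr rho2 ->
  phi rho1 rho2 eps Cm (X + (t%:C)%:M) (Y - (t%:C)%:M) = phi rho1 rho2 eps Cm X Y.
Proof.
move=> e; rewrite /phi /betaQ Cxy_shift.
have -> : \tr (rho1 *m (X + (t%:C)%:M)) = \tr (rho1 *m X) + t%:C * \tr rho1.
  by rewrite mulmxDr mxtraceD mul_mx_scalar mxtraceZ.
have -> : \tr (rho2 *m (Y - (t%:C)%:M)) = \tr (rho2 *m Y) - t%:C * \tr rho2.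
  by rewrite mulmxBr raddfB /= mul_mx_scalar mxtraceZ.
rewrite ReD ReB e; do 3!move: (complex.Re _) => ?.
by move: (logdet _) => ?; ring.
Qed.

Lemma weak_duality Cm X Y rho : Dhat Cm X Y -> Gamma_o rho1 rho2 rho ->
  phi rho1 rho2 eps Cm X Y <= kobj Cm eps rho ?= iff (eps%:C *: invmx (Cxy Cm X Y) == rho).
Proof.
move=> [_ [_ pM]] [[_ [r2 r1]] prho]; set M := Cxy Cm X Y in pM *.
have pA := pd_scale eps_gt0 (pd_inv pM).
have eM : invmx (eps%:C *: invmx M) = (eps^-1)%:C *: M.
  have epsC : eps%:C != 0 :> C by rewrite fmorph_eq0 gt_eqF.
  by rewrite invmxZ ?pd_unit ?pd_inv // invmxK fmorphV.
have := logdet_tangent pA prho.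
rewrite eM -scalemxAl mxtraceZ ReMl logdet_scale_inv // => h.
(* The duality gap is [eps] times the defect in the tangent inequality; the constant term of [phi]
   is what makes this exact. *)
have e : kobj Cm eps rho - phi rho1 rho2 eps Cm X Y = eps * (((n1 * n2)%:R * ln eps -
    logdet M + eps^-1 * complex.Re (\tr (M *m rho)) - (n1 * n2)%:R) - logdet rho).
  rewrite /kobj (tr_Cxy Cm X Y) -/M r1 r2 !ReD /phi /betaQ -/M.
  rewrite [\tr (X *m _)]mxtrace_mulC [\tr (Y *m _)]mxtrace_mulC.
  do 3!move: (complex.Re _) => ?; do 2!move: (logdet _) => ?.
  by field; rewrite gt_eqF.
split; first by rewrite -subr_ge0 e pmulr_rge0 // subr_ge0 h.1.
by rewrite -h.2 eq_sym -subr_eq0 e mulf_eq0 (gt_eqF eps_gt0) /= subr_eq0 eq_sym.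
Qed.

(** [D] does not change the marginals, so [rho + t D] is feasible for small [t] of either sign. The
    expansion of [logdet] makes a quadratic in [t] with this linear coefficient nonnegative near
    0. *)
Lemma minimizer_stationary Cm rho D : Gamma_o rho1 rho2 rho ->
  (forall sigma, Gamma_o rho1 rho2 sigma -> kobj Cm eps rho <= kobj Cm eps sigma) ->
  herm D -> ptrace2 D = 0 -> ptrace1 D = 0 ->
  complex.Re (\tr ((Cm - eps%:C *: invmx rho) *m D)) = 0.
Proof.
move=> [[_ [r2 r1]] prho] rho_min hD D2 D1.
have [delta d0 [K hK]] := logdet_first_order prho hD.
apply: (@quadratic_ge0_eq0 delta _ (eps * K)) => // t /hK[pt lt].
have : kobj Cm eps rho <= kobj Cm eps (rho + t%:C *: D).
  apply: rho_min; split=> //; split; first exact: pd_psd.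
  by rewrite ptrace2D ptrace1D ptrace2Z ptrace1Z D1 D2 !scaler0 !addr0.
rewrite /kobj mulmxDr mxtraceD -scalemxAr mxtraceZ ReD ReMl.
rewrite mulmxBl raddfB /= -scalemxAl mxtraceZ ReB ReMl.
move: lt; move: (complex.Re (\tr (Cm *m rho))) (complex.Re _) (complex.Re _) => a b c.
move: (logdet _) (logdet _) => u v uv h.
have := ler_wpM2l (ltW eps_gt0) uv; rewrite !mulrBr !mulrDr; move: h; nra.
Qed.
End Duality.

(** * Strong duality and the description of the optima *)

(** Stationarity of a primal minimizer [rho] provides [(X, Y)] with [Cxy Cm X Y] equal to [eps]
    times the inverse of [rho]; inverting this relation returns [rho]. *)
Lemma dual_point_exists (R : realType) (n1 n2 : nat) (eps : R)
    (rho1 : 'M[R[i]]_n1) (rho2 : 'M[R[i]]_n2) (Cm : 'M[R[i]]_(n1 * n2)) :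
  (0 < n1)%N -> (0 < n2)%N -> 0 < eps ->
  pd rho1 -> pd rho2 -> \tr rho1 = \tr rho2 -> herm Cm ->
  exists U1 U2, Dset Cm U1 U2 /\ Gamma_o rho1 rho2 (eps%:C *: invmx (Cxy Cm U1 U2)).
Proof.
move=> n1_gt0 n2_gt0 eps0 p1 p2 e hC.
have [rho Grho rho_min] := kobj_min_exists Cm eps0
  (ex_intro _ _ (Gamma_o_product n1_gt0 n2_gt0 p1 p2 e)).
have prho : pd rho by exact: Grho.2.
have pS := pd_scale eps0 (pd_inv prho).
have hH : herm (Cm - eps%:C *: invmx rho) by apply: hermB => //; apply: pd_herm.
have [X [Y [hX hY eXY]]] := orthogonal_ptrace_ker n1_gt0 n2_gt0 hH
  (fun D => minimizer_stationary eps0 Grho rho_min).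
(* The solution of [\tr X + n1 t = \tr Y - n2 t]: the shift along the line that reaches [Dset]. *)
pose t : R := (complex.Re (\tr Y) - complex.Re (\tr X)) / (n1%:R + n2%:R).
have n12 : (n1%:R + n2%:R : R) != 0 by rewrite -natrD pnatr_eq0 addn_eq0 -!leqn0 leqNgt n1_gt0.
have eC : Cxy Cm X Y = eps%:C *: invmx rho.
  by rewrite /Cxy -addrA -opprD -eXY opprB addrC subrK.
have pt : Dset Cm (X + (t%:C)%:M) (Y - (t%:C)%:M).
  split; [split; [|split]|].
  - by apply: hermD => //; apply: herm_scalar.
  - by apply: hermB => //; apply: herm_scalar.
  - by rewrite Cxy_shift eC.
  rewrite mxtraceD raddfB /= !mxtrace_scalar (herm_tr_real hX) (herm_tr_real hY).
  apply/eqP; rewrite -!(rmorphMn (real_complex R)) -rmorphD -rmorphB; apply/eqP.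
  congr (_%:C); rewrite -[t *+ n1]mulr_natr -[t *+ n2]mulr_natr.
  apply/eqP; rewrite -subr_eq0; apply/eqP.
  transitivity (complex.Re (\tr X) - complex.Re (\tr Y) + t * (n1%:R + n2%:R)).
    by ring.
  by rewrite /t divfK //; ring.
exists (X + (t%:C)%:M), (Y - (t%:C)%:M); split; first exact: pt.
rewrite Cxy_shift eC.
have epsC : eps%:C != 0 :> R[i] by rewrite fmorph_eq0 gt_eqF.
rewrite invmxZ ?invmxK ?scalerA ?divff ?scale1r //.
by rewrite pd_unit.
Qed.

Theorem theorem1p2 (R : realType) (n1 n2 : nat) (eps : R)
  (rho1 : 'M[R[i]]_n1) (rho2 : 'M[R[i]]_n2) (Cm : 'M[R[i]]_(n1 * n2)) :
  (0 < n1)%N -> (0 < n2)%N -> 0 < eps ->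
  pd rho1 -> pd rho2 -> \tr rho1 = \tr rho2 -> herm Cm ->
  let f := phi rho1 rho2 eps Cm in
  (* concave on Dhat *)
  (forall X1 Y1 X2 Y2 (t : R), Dhat Cm X1 Y1 -> Dhat Cm X2 Y2 -> 0 <= t <= 1 ->
     t * f X1 Y1 + (1 - t) * f X2 Y2 <= f (cvx t X1 X2) (cvx t Y1 Y2)) /\
  (* strictly concave on D *)
  (forall X1 Y1 X2 Y2 (t : R), Dset Cm X1 Y1 -> Dset Cm X2 Y2 ->
     (X1, Y1) <> (X2, Y2) -> 0 < t < 1 ->
     t * f X1 Y1 + (1 - t) * f X2 Y2 < f (cvx t X1 X2) (cvx t Y1 Y2)) /\
  exists (U1 : 'M[R[i]]_n1) (U2 : 'M[R[i]]_n2),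
    Dset Cm U1 U2 /\
    (* f(U1,U2) is the maximum over Dhat and over D *)
    (forall X Y, Dhat Cm X Y -> f X Y <= f U1 U2) /\
    (forall X Y, Dset Cm X Y -> f X Y <= f U1 U2) /\
    (* the set of maximizers on Dhat is exactly the line L *)
    (forall t : R, Dhat Cm (U1 + (t%:C)%:M) (U2 - (t%:C)%:M) /\
                   f (U1 + (t%:C)%:M) (U2 - (t%:C)%:M) = f U1 U2) /\
    (forall X Y, Dhat Cm X Y -> f X Y = f U1 U2 ->
       exists t : R, X = U1 + (t%:C)%:M /\ Y = U2 - (t%:C)%:M) /\
    (* L meets D only at (U1,U2) *)
    (forall t : R, Dset Cm (U1 + (t%:C)%:M) (U2 - (t%:C)%:M) -> t = 0) /\
    (* C(X,Y), hence rho*, is constant along L *)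
    (forall t : R, Cxy Cm (U1 + (t%:C)%:M) (U2 - (t%:C)%:M) = Cxy Cm U1 U2) /\
    f U1 U2 = kappa_beta Cm rho1 rho2 eps /\
    (* rho* = eps C(U1,U2)^{-1} is the unique minimizer of kappa_beta on Gamma_o *)
    let rs := (eps%:C) *: invmx (Cxy Cm U1 U2) in
    Gamma_o rho1 rho2 rs /\
    kobj Cm eps rs = kappa_beta Cm rho1 rho2 eps /\
    (forall rho, Gamma_o rho1 rho2 rho -> kobj Cm eps rs <= kobj Cm eps rho) /\
    (forall rho, Gamma_o rho1 rho2 rho -> kobj Cm eps rho = kobj Cm eps rs -> rho = rs).
Proof.
move=> n1_gt0 n2_gt0 eps0 p1 p2 e hC f.
split.
  move=> X1 Y1 X2 Y2 t [_ [_ q1]] [_ [_ q2]] t01.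
  rewrite -subr_ge0 phi_cvx mulr_ge0 ?(ltW eps0) // subr_ge0.
  exact: logdet_concave.
split.
  move=> X1 Y1 X2 Y2 t D1 [[h2 [_ q2]] e2] neq t01; have [[h1 [_ q1]] _] := D1.
  rewrite -subr_gt0 phi_cvx mulr_gt0 // subr_gt0.
  (* Equal values of [Cxy] would make the two points differ by a shift, which the trace condition
     forces to be zero. *)
  apply: logdet_strict_concave => //; apply/eqP => eqC; apply: neq.
  have [c [eX eY]] := Cxy_inj n1_gt0 n2_gt0 h1 h2 eqC.
  suff c0 : c = 0 by rewrite eX eY c0 rmorph0 raddf0 addr0 subr0.
  apply: (@Dset_shift_eq0 _ _ _ Cm X2 Y2 _ n1_gt0 e2).
  by rewrite -eX -eY; exact: D1.
have [U1 [U2 [DU GU]]] := dual_point_exists n1_gt0 n2_gt0 eps0 p1 p2 e hC.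
set rs := eps%:C *: invmx (Cxy Cm U1 U2) in GU *.
have [DhU eU] := DU.
(* The equality case of weak duality. The pair of [(U1, U2)] and [rs] then certifies both optima:
   weak duality against one of them bounds the other problem. *)
have fU : f U1 U2 = kobj Cm eps rs.
  by apply/eqP; rewrite (weak_duality eps0 DhU GU).2.
have fmax X Y : Dhat Cm X Y -> f X Y <= f U1 U2.
  by move=> DXY; rewrite fU; exact: (weak_duality eps0 DXY GU).1.
have kmin rho : Gamma_o rho1 rho2 rho -> kobj Cm eps rs <= kobj Cm eps rho.
  by move=> Grho; rewrite -fU; exact: (weak_duality eps0 DhU Grho).1.
have kE : kappa_beta Cm rho1 rho2 eps = kobj Cm eps rs.
  by apply: inf_min; [exists rs | move=> _ [rho Grho <-]; apply: kmin].
exists U1, U2; split; first exact: DU.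
split; first exact: fmax.
split; first by move=> X Y [DXY _]; exact: fmax.
split.
  move=> t; split; last exact: phi_shift.
  case: DhU => h1 [h2 pU]; split; first by apply: hermD => //; apply: herm_scalar.
  by split; [apply: hermB => //; apply: herm_scalar | rewrite Cxy_shift].
split.
  (* Another maximizer also has zero gap against [rs], hence the same [Cxy], and lies on the line by
     [Cxy_inj]. *)
  move=> X Y DXY eXY; have := (weak_duality eps0 DXY GU).2.
  rewrite -/f eXY fU eqxx => /esym/eqP/scalerI ers.
  have epsC : eps%:C != 0 :> R[i] by rewrite fmorph_eq0 gt_eqF.
  apply: (Cxy_inj n1_gt0 n2_gt0 DXY.1 DhU.1).
  exact: (can_inj (@invmxK _ _)) (ers epsC).
split; first by move=> t; apply: Dset_shift_eq0.
split; first by move=> t; apply: Cxy_shift.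
split; first by rewrite kE.
split; first exact: GU.
split; first by rewrite kE.
split; first exact: kmin.
move=> rho Grho ek.
(* Another minimizer has zero gap against [(U1, U2)], and the equality case identifies it with
   [rs]. *)
by apply/esym/eqP; rewrite -(weak_duality eps0 DhU Grho).2 -/f fU ek.
Qed.
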